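(* Let $p\ge 1$ be an integer, $h>0$, $H=ph$, and let $\boldsymbol{\theta}^{(0,0)}=(\theta_1^{(0)},\theta_2^{(0)})\in\left[-\frac{\pi}{p},\frac{\pi}{p}\right)^2$. Then the spaces $\mathbf{E}_h(\boldsymbol{\theta}^{(0,0)})$ and $\mathbf{F}_H(p\,\boldsymbol{\theta}^{(0,0)})$ are equivalent, i.e. they are the same space of functions on the grid $\mathbf{G}_h$: $$\mathbf{E}_h(\boldsymbol{\theta}^{(0,0)})=\mathbf{F}_H(p\,\boldsymbol{\theta}^{(0,0)}).$$
   Context: $\iota^2=-1$. $\mathbf{G}_h=\{\boldsymbol{x}_{s,t}=(sh,th):(s,t)\in\mathbb{Z}^2\}$ is the infinite uniform grid; all functions are complex-valued functions on $\mathbf{G}_h$ and spans are over $\mathbb{C}$. For $0\le q,r<p$ let $\boldsymbol{\theta}^{(q,r)}=\left(\theta_1^{(0)}+\frac{2\pi q}{p},\ \theta_2^{(0)}+\frac{2\pi r}{p}\right)$. The classical space of Fourier harmonics for factor-$p$ coarsening is $$\mathbf{E}_h(\boldsymbol{\theta}^{(0,0)})=\mathrm{span}\left\{\psi(\boldsymbol{\theta}^{(q,r)},\boldsymbol{x}_{s,t})=e^{\iota\boldsymbol{\theta}^{(q,r)}\cdot\boldsymbol{x}_{s,t}/h}: q,r=0,1,\dots,p-1\right\}.$$ For $\boldsymbol{\theta}\in[-\pi,\pi)^2$, the ''sparse'' space is $$\mathbf{F}_H(\boldsymbol{\theta})=\mathrm{span}\left\{\varphi_{k,\ell}(\boldsymbol{\theta},\boldsymbol{x}_{s,t})=e^{\iota\boldsymbol{\theta}\cdot\boldsymbol{x}_{s,t}/H}\chi_{k,\ell}(\boldsymbol{x}_{s,t}):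 k,\ell=0,1,\dots,p-1\right\},$$ where $\chi_{k,\ell}(\boldsymbol{x}_{s,t})=1$ if $s\equiv k$ and $t\equiv\ell \pmod p$, and $\chi_{k,\ell}(\boldsymbol{x}_{s,t})=0$ otherwise. *)

(* Defs.v *)
From mathcomp Require Import all_boot all_order all_algebra.
From mathcomp Require Import complex.
From mathcomp Require Import all_classical all_reals all_analysis.

Set Implicit Arguments.
Unset Strict Implicit.
Unset Printing Implicit Defensive.

Import Order.TTheory GRing.Theory Num.Theory.

Local Open Scope classical_set_scope.
Local Open Scope ring_scope.
Local Open Scope complex_scope.

Definition cexp (R : realType) (z : R[i]) : R[i] :=
  (expR (complex.Re z))%:C * (cos (complex.Im z) +i* sin (complex.Im z)).

Definition lin_span (K : pzRingType) (V : lmodType K) (I : finType)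
    (f : I -> V) : set V :=
  [set v | exists c : I -> K, v = \sum_i c i *: f i].

Definition dot (R : realType) (u v : R * R) : R := u.1 * v.1 + u.2 * v.2.

Definition gridpt (R : realType) (h : R) (s t : int) : R * R :=
  (s%:~R * h, t%:~R * h).

Definition grid (R : realType) (h : R) : set (R * R) :=
  [set x | exists s t : int, x = gridpt h s t].

(* The scalars are R[i], so that spans are taken over the complex numbers. *)
Definition gridfun (R : realType) (h : R) : lmodType R[i] := grid h -> R[i].

Definition fourier_mode (R : realType) (h : R) (theta : R * R) : gridfun h :=
  fun x => cexp ('i%C * (dot theta (val x) / h)%:C).

Arguments fourier_mode {R} h theta.

Definition shifted_freq (R : realType) (p : nat) (theta : R * R) (q r : nat) :
    R * R :=
  (theta.1 + 2 * pi * q%:R / p%:R, theta.2 + 2 * pi * r%:R / p%:R).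

Definition E_space (R : realType) (p : nat) (h : R) (theta : R * R) :
    set (gridfun h) :=
  lin_span (fun qr : 'I_p * 'I_p =>
    fourier_mode h (shifted_freq p theta qr.1 qr.2)).

Arguments E_space {R} p h theta.

(* The support of chi_{k,l}: for h <> 0 the indices s, t of a grid point are
   uniquely determined. *)
Definition subgrid (R : realType) (p : nat) (h : R) (k l : nat) :
    set (R * R) :=
  [set x | exists s t : int,
     [/\ x = gridpt h s t, (s = k %[mod p])%Z & (t = l %[mod p])%Z]].

Definition sparse_mode (R : realType) (p : nat) (h H : R) (theta : R * R)
    (k l : nat) : gridfun h :=
  fun x => cexp ('i%C * (dot theta (val x) / H)%:C) *
    \1_(subgrid p h k l) (val x).

Arguments sparse_mode {R} p h H theta k l.

Definition F_space (R : realType) (p : nat) (h H : R) (theta : R * R) :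
    set (gridfun h) :=
  lin_span (fun kl : 'I_p * 'I_p => sparse_mode p h H theta kl.1 kl.2).

Arguments F_space {R} p h H theta.

(* Main.v *)
Require Import Defs.
From mathcomp Require Import all_boot all_order all_algebra.
From mathcomp Require Import complex.
From mathcomp Require Import all_classical all_reals all_analysis.
From mathcomp Require Import ring.

Import Order.TTheory GRing.Theory Num.Theory.

Local Open Scope classical_set_scope.
Local Open Scope ring_scope.

(** Both spaces carry the common factor [exp(i theta . (s, t))]: at the grid
    point [(s h, t h)] the phase of a Fourier mode is
    [theta . (s, t) + 2 pi (q s + r t) / p], while the phase of a sparse mode
    is [p theta . (s, t) h / H = theta . (s, t)].  What is left is, in each of
    the two index variables separately, a comparison of two families of
    functions on the integers: the characters [s |-> exp(2 pi i q s / p)] and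
    the indicators of the residue classes [s = k (mod p)].  Both are bases of
    the [p]-periodic functions: a character is the combination of the
    indicators with its own values as coefficients ([character_residues]), and
    the discrete Fourier inversion formula, that is orthogonality of characters
    ([sum_character]), expresses an indicator through the characters
    ([residue_characters]).  Multiplying these one-dimensional expansions
    yields the two inclusions ([lin_span_tensor]). *)

(** * Spans of product families *)

Lemma lin_span_sub {K : pzRingType} {V : lmodType K} {I J : finType}
    (f : I -> V) (g : J -> V) :
  (forall i, lin_span g (f i)) -> lin_span f `<=` lin_span g.
Proof.
move=> fg _ [c ->]; have [a fE] := choice fg.
exists (fun j => \sum_i c i * a i j).
under eq_bigr do rewrite fE scaler_sumr.
rewrite exchange_big; apply: eq_bigr => j _.
by rewrite scaler_suml; apply: eq_bigr => i _; rewrite scalerA.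
Qed.

(** A change of family in one variable, with matrix [a], induces one on
    products in two variables, with the Kronecker square of [a] as matrix;
    a common weight [b] does not interfere. *)
Lemma lin_span_tensor {K : comPzRingType} {X Y : Type} {I J : finType}
    (s t : X -> Y) (b : X -> K) (u : I -> Y -> K) (v : J -> Y -> K)
    (a : I -> J -> K) :
  (forall i y, u i y = \sum_j a i j * v j y) ->
  lin_span (fun ij : I * I => (fun x => b x * (u ij.1 (s x) * u ij.2 (t x)))
    : X -> K^o) `<=`
  lin_span (fun kl : J * J => (fun x => b x * (v kl.1 (s x) * v kl.2 (t x)))
    : X -> K^o).
Proof.
move=> uE; apply: lin_span_sub => -[i j] /=.
exists (fun kl => a i kl.1 * a j kl.2); apply/funext => x.
rewrite fct_sumE !uE big_distrlr /= pair_bigA /= mulr_sumr.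
by apply: eq_bigr => -[k l] _ /=; rewrite -[RHS]/(_ * _); ring.
Qed.

(** * The unit circle *)

(** The point [exp(i x)], written with [cexp] so that the exponential factor of
    either kind of mode is, by definition, a value of [expi]. *)
Definition expi {R : realType} (x : R) : R[i] := cexp ('i%C * x%:C)%C.

Lemma expiE {R : realType} (x : R) : expi x = (cos x +i* sin x)%C.
Proof.
by rewrite /expi /cexp /= !(mul0r, mul1r, mulr0, add0r, oppr0) expR0 mul1r.
Qed.

Lemma expi0 {R : realType} : expi (0 : R) = 1.
Proof. by rewrite expiE cos0 sin0. Qed.

Lemma expiD {R : realType} (x y : R) : expi (x + y) = expi x * expi y.
Proof.
rewrite !expiE cosD sinD; apply/eqP; rewrite eq_complex /=.
by rewrite eqxx /=; apply/eqP; ring.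
Qed.

Lemma expiMn {R : realType} (x : R) n : expi (x *+ n) = expi x ^+ n.
Proof.
by elim: n => [|n IHn]; rewrite ?mulr0n ?expi0 // mulrS expiD IHn exprS.
Qed.

Lemma expi_2pi_int {R : realType} (m : int) : expi (2 * pi * m%:~R : R) = 1.
Proof.
have e1 : expi (2 * pi : R) = 1.
  by rewrite expiE mulr_natl cos2pi sin2pi.
have en n : expi (2 * pi * n%:R : R) = 1.
  by rewrite mulr_natr expiMn e1 expr1n.
case: m => n; first exact: en.
rewrite NegzE rmorphN /= mulrN -[LHS]mulr1 -(en n.+1) -expiD.
by rewrite addNr expi0.
Qed.

(** By the half-angle formula [cos x = 1 - 2 sin(x/2)^2], the value 1 is only
    reached where [sin (x/2)] vanishes, which excludes the open interval. *)
Lemma expi_neq1 {R : realType} (x : R) : 0 < x < 2 * pi -> expi x != 1.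
Proof.
case/andP=> x0 x2pi; rewrite expiE eq_complex /= negb_and; apply/orP; left.
have s0 : 0 < sin (x / 2).
  by apply: sin_gt0_pi; rewrite divr_gt0 // ltr_pdivrMr // mulrC.
rewrite [x]splitr cosD -!expr2 cos2sin2 -subr_eq0.
rewrite [X in X != 0](_ : _ = - sin (x / 2) ^+ 2 *+ 2); last by ring.
by rewrite mulrn_eq0 oppr_eq0 expf_neq0 // gt_eqF.
Qed.

(** * Characters and residue classes modulo p *)

Section Characters.
Context {R : realType} (p : nat) (p_gt0 : (0 < p)%N).

Definition character (q : nat) (n : int) : R[i] :=
  expi (2 * pi * q%:R * n%:~R / p%:R).

Definition residue (k : nat) (n : int) : R[i] := ((n == k %[mod p])%Z)%:R.

Let pR_neq0 : p%:R != 0 :> R. Proof. by rewrite pnatr_eq0 -lt0n. Qed.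

Lemma characterD q m n : character q (m + n) = character q m * character q n.
Proof. by rewrite /character rmorphD /= -expiD; congr expi; ring. Qed.

(** Reducing [n] modulo [p] changes the phase by a multiple of [2 pi]. *)
Lemma character_modz q n : character q (n %% p)%Z = character q n.
Proof.
have turn : character q ((n %/ p)%Z * p) = 1.
  rewrite -(expi_2pi_int (q%:Z * (n %/ p)%Z)) /character.
  by congr expi; rewrite !rmorphM /= -!pmulrn; field.
by rewrite [in RHS](divz_eq n p) [RHS]characterD turn mul1r.
Qed.

Lemma character_exp q n : character q n = character 1 n ^+ q.
Proof. by rewrite -expiMn -mulr_natr; congr expi; ring. Qed.

(** Orthogonality: the sum is geometric, with ratio [z = character 1 n]
    satisfying [z ^+ p = 1]; it vanishes unless [z = 1], that is unless [p]
    divides [n]. *)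
Lemma sum_character n :
  \sum_(q < p) character q n = p%:R * ((p %| n)%Z)%:R.
Proof.
under eq_bigr do rewrite character_exp.
have [pn|pNn] := boolP (p %| n)%Z.
  have -> : character 1 n = 1.
    rewrite -character_modz (dvdz_mod0P pn) /character.
    by rewrite mulr0 mul0r expi0.
  under eq_bigr do rewrite expr1n.
  by rewrite sumr_const card_ord mulr1.
rewrite mulr0.
have z1 : character 1 n != 1.
  rewrite -character_modz; apply: expi_neq1.
  (* the reduced phase lies strictly between 0 and a full turn *)
  have : (0 < (n %% p)%Z < p)%R.
    rewrite ltz_pmod // andbT lt0r modz_ge0 -?lt0n // andbT.
    by apply: contra pNn => /eqP /dvdz_mod0P.
  case/andP=> r0 rp; rewrite mulr1 -mulrA; apply/andP; split.
    by rewrite !mulr_gt0 ?pi_gt0 ?ltr0z ?invr_gt0 ?ltr0n.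
  rewrite gtr_pMr ?mulr_gt0 ?pi_gt0 // ltr_pdivrMr ?ltr0n // mul1r.
  by rewrite pmulrn ltr_int.
have z1' : character 1 n - 1 != 0 by rewrite subr_eq0.
apply: (mulfI z1').
rewrite -subrX1 -character_exp mulr0 /character.
rewrite [X in expi X](_ : _ = 2 * pi * n%:~R) ?expi_2pi_int ?subrr //.
by field.
Qed.

(** Expansion of the [p]-periodic function [character q] along residue classes:
    only the class of [n] contributes. *)
Lemma character_residues q n :
  character q n = \sum_(k < p) character q k%:Z * residue k n.
Proof.
have n_abs : `|(n %% p)%Z|%N%:Z = (n %% p)%Z.
  by rewrite gez0_abs // modz_ge0 // -lt0n.
have n_ltp : (`|(n %% p)%Z| < p)%N by rewrite -ltz_nat n_abs ltz_pmod.
rewrite (bigD1 (Ordinal n_ltp)) //= big1 ?addr0 => [|k kNn].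
  by rewrite /residue n_abs modz_mod eqxx mulr1 character_modz.
rewrite /residue [(_ == _)%Z](_ : _ = false) ?mulr0 //.
apply: contraNF kNn => /eqP nk; apply/eqP/val_inj => /=.
by rewrite nk modz_nat absz_nat modn_small.
Qed.

(** Fourier inversion: this is [sum_character] at the shifted argument [n - k]. *)
Lemma residue_characters k n :
  residue k n = \sum_(q < p) (character q (- k%:Z) / p%:R) * character q n.
Proof.
under eq_bigr do rewrite mulrAC -characterD.
rewrite -mulr_suml sum_character /residue eqz_mod_dvd addrC mulrAC mulfV.
  by rewrite mul1r.
by rewrite pnatr_eq0 -lt0n.
Qed.

End Characters.

(** * Fourier and sparse modes in grid indices *)

Lemma gridpt_inj {R : realType} {h : R} {s t s' t' : int} :
  0 < h -> gridpt h s t = gridpt h s' t' -> s = s' /\ t = t'.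
Proof.
move=> h0; have hI := mulIf (lt0r_neq0 h0).
by move=> [/hI/intr_inj -> /hI/intr_inj ->].
Qed.

(** The shift [2 pi (q, r) / p] of the frequency splits off as a product of two
    characters. *)
Lemma fourier_modeE {R : realType} (p : nat) (h : R) (theta : R * R) q r
    (x : grid h) (s t : int) : (0 < p)%N -> 0 < h -> val x = gridpt h s t ->
  fourier_mode h (shifted_freq p theta q r) x =
  expi (dot theta (s%:~R, t%:~R)) * (character p q s * character p r t).
Proof.
move=> p0 h0 xE; rewrite /fourier_mode -/(expi _) xE -!expiD; congr expi.
rewrite /dot /shifted_freq /=; field.
by rewrite pnatr_eq0 -lt0n p0 lt0r_neq0.
Qed.

(** Scaling the frequency by [p] compensates for the coarse mesh size [p h];
    the indicator factors because the indices of a grid point are unique. *)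
Lemma sparse_modeE {R : realType} (p : nat) (h : R) (theta : R * R) k l
    (x : grid h) (s t : int) : (0 < p)%N -> 0 < h -> val x = gridpt h s t ->
  sparse_mode p h (p%:R * h) (p%:R * theta.1, p%:R * theta.2) k l x =
  expi (dot theta (s%:~R, t%:~R)) * (residue p k s * residue p l t).
Proof.
move=> p0 h0 xE; rewrite /sparse_mode -/(expi _) xE; congr (expi _ * _).
  rewrite /dot /=; field.
  by rewrite lt0r_neq0 // pnatr_eq0 -lt0n p0.
rewrite indicE /residue -natrM mulnb; congr (_%:R); congr nat_of_bool.
apply/idP/idP => [/set_mem[s' [t' [/(gridpt_inj h0)[-> ->] -> ->]]]|].
  by rewrite !eqxx.
by case/andP=> /eqP sk /eqP tl; apply/mem_set; exists s, t.
Qed.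

Theorem theorem4p3 (R : realType) (p : nat) (h H : R) (theta : R * R) :
  (1 <= p)%N -> 0 < h -> H = p%:R * h ->
  - (pi / p%:R) <= theta.1 < pi / p%:R ->
  - (pi / p%:R) <= theta.2 < pi / p%:R ->
  E_space p h theta = F_space p h H (p%:R * theta.1, p%:R * theta.2).
Proof.
move=> p0 h0 -> _ _.
have /choice[st stE] : forall x : grid h,
    exists st : int * int, val x = gridpt h st.1 st.2.
  by move=> x; have [s [t xE]] := set_mem (valP x); exists (s, t).
pose b x := expi (dot theta ((st x).1%:~R, (st x).2%:~R)).
pose s x := (st x).1; pose t x := (st x).2.
have E_tensor : (fun qr : 'I_p * 'I_p =>
      fourier_mode h (shifted_freq p theta qr.1 qr.2)) =
    (fun qr x => b x * (character p qr.1 (s x) * character p qr.2 (t x))).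
  by apply/funext => qr; apply/funext => x; exact: fourier_modeE.
have F_tensor : (fun kl : 'I_p * 'I_p =>
      sparse_mode p h (p%:R * h) (p%:R * theta.1, p%:R * theta.2) kl.1 kl.2) =
    (fun kl x => b x * (residue p kl.1 (s x) * residue p kl.2 (t x))).
  by apply/funext => kl; apply/funext => x; exact: sparse_modeE.
rewrite /E_space /F_space E_tensor F_tensor; apply/seteqP; split.
  apply: (lin_span_tensor s t b (fun q : 'I_p => character p q)
    (fun k : 'I_p => residue p k) (fun q k => character p q k%:Z)) => q n.
  exact: character_residues.
apply: (lin_span_tensor s t b (fun k : 'I_p => residue p k)
  (fun q : 'I_p => character p q)
  (fun k q => character p q (- k%:Z) / p%:R)) => k n.
exact: residue_characters.
Qed.
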